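(* Let $m\ge 3$. The growth function for the submonoid generated by the $m$ generators of the free nil-$2$ group on $m$ generators is in $\Theta\left(n^{m^2-1}\right)$.
   Context: The commutator in a group is $[x,y]=x^{-1}y^{-1}xy$. The free nil-$2$ group on the set of generators $\Sigma=\{1,\ldots,m\}$ is $N_2(\Sigma)=\langle\Sigma\mid [x,y]z=z[x,y]\ (x,y,z\in\Sigma)\rangle$. The growth function of the submonoid generated by $\Sigma$ maps $n$ to the number of elements of $N_2(\Sigma)$ that can be written as a product of exactly $n$ generators from $\Sigma$ (no inverses). $f\in\Theta(g)$ means that there exist constants $A,B>0$ such that $A\,g(n)\le f(n)\le B\,g(n)$ for all $n$ large enough. *)

(* Defs.v *)
From HB Require Import structures.
From mathcomp Require Import all_boot all_order all_algebra finmap.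
From mathcomp Require Import all_classical all_reals all_analysis.

Set Implicit Arguments.
Unset Strict Implicit.
Unset Printing Implicit Defensive.

Local Open Scope quotient_scope.

Section Presentation.
Variable S : choiceType.

(* The letter (s, true) stands for s and (s, false) for its inverse. *)
Definition word := seq (S * bool).

Definition gen_word (s : S) : word := [:: (s, true)].

Definition inv_letter (a : S * bool) : S * bool := (a.1, ~~ a.2).

Definition inv_word (w : word) : word := rev (map inv_letter w).

Definition comm_word (x y : word) : word := inv_word x ++ inv_word y ++ x ++ y.

Variable rel : word -> word -> Prop.

(* Equality of words in the group < S | u = v for all u, v with rel u v >. *)
Inductive pres_eq : word -> word -> Prop :=
  | pres_eq_refl u : pres_eq u u
  | pres_eq_sym u v : pres_eq u v -> pres_eq v u
  | pres_eq_trans u v w : pres_eq u v -> pres_eq v w -> pres_eq u w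
  | pres_eq_cat u u' v v' :
      pres_eq u u' -> pres_eq v v' -> pres_eq (u ++ v) (u' ++ v')
  | pres_eq_cancel a : pres_eq [:: a; inv_letter a] [::]
  | pres_eq_rel u v : rel u v -> pres_eq u v.

Definition pres_eqb (u v : word) : bool := `[< pres_eq u v >].

Lemma pres_eqb_refl : reflexive pres_eqb.
Proof. by move=> u; apply/asboolP; exact: pres_eq_refl. Qed.

Lemma pres_eqb_sym : symmetric pres_eqb.
Proof. by move=> u v; apply/asboolP/asboolP => /pres_eq_sym. Qed.

Lemma pres_eqb_trans : transitive pres_eqb.
Proof.
by move=> v u w /asboolP uv /asboolP vw; apply/asboolP/(pres_eq_trans uv).
Qed.

Canonical pres_equiv :=
  EquivRel pres_eqb pres_eqb_refl pres_eqb_sym pres_eqb_trans.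

Definition presented := {eq_quot pres_equiv}.

HB.instance Definition _ := Choice.on presented.
HB.instance Definition _ := EqQuotient.on presented.

Definition pres_class (w : word) : presented := \pi_presented w.

Lemma pres_classP (u v : word) : pres_class u = pres_class v <-> pres_eq u v.
Proof.
split=> [/eqmodP/asboolP //|uv].
by apply/eqmodP/asboolP.
Qed.

Lemma inv_letterK : involutive inv_letter.
Proof. by case=> s b; rewrite /inv_letter negbK. Qed.

Lemma inv_wordK : involutive inv_word.
Proof. by move=> w; rewrite /inv_word map_rev revK (mapK inv_letterK). Qed.

Lemma inv_word_cat u v : inv_word (u ++ v) = inv_word v ++ inv_word u.
Proof. by rewrite /inv_word map_cat rev_cat. Qed.

Lemma pres_eq_mulV w : pres_eq (w ++ inv_word w) [::].
Proof.
elim: w => [|a w IHw]; first exact: pres_eq_refl.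
rewrite -cat1s inv_word_cat -catA [w ++ _ ++ _]catA.
apply: pres_eq_trans (pres_eq_cancel a).
exact/(pres_eq_cat (pres_eq_refl [:: a]))/(pres_eq_cat IHw)/pres_eq_refl.
Qed.

Lemma pres_eq_Vmul w : pres_eq (inv_word w ++ w) [::].
Proof. by rewrite -{2}[w]inv_wordK; exact: pres_eq_mulV. Qed.

Lemma pres_eq_inv u v : pres_eq u v -> pres_eq (inv_word u) (inv_word v).
Proof.
move=> uv; apply: (@pres_eq_trans _ (inv_word u ++ v ++ inv_word v)).
  rewrite -[X in pres_eq X]cats0; apply: pres_eq_cat (pres_eq_refl _) _.
  exact/pres_eq_sym/pres_eq_mulV.
rewrite catA -[X in pres_eq _ X]cat0s.
apply: pres_eq_cat (pres_eq_refl _).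
apply: pres_eq_trans (pres_eq_Vmul u).
exact/(pres_eq_cat (pres_eq_refl _))/pres_eq_sym.
Qed.

Definition pres_one : presented := pres_class [::].
Definition pres_inv (x : presented) : presented :=
  pres_class (inv_word (repr x)).
Definition pres_mul (x y : presented) : presented :=
  pres_class (repr x ++ repr y).

Lemma pres_repr w : pres_eq (repr (pres_class w)) w.
Proof. by apply/pres_classP; rewrite /pres_class reprK. Qed.

Lemma pres_classK (x : presented) : pres_class (repr x) = x.
Proof. exact: reprK. Qed.

Lemma pres_mulE u v :
  pres_mul (pres_class u) (pres_class v) = pres_class (u ++ v).
Proof. by apply/pres_classP/pres_eq_cat; exact: pres_repr. Qed.

Lemma pres_invE u : pres_inv (pres_class u) = pres_class (inv_word u).
Proof. by apply/pres_classP/pres_eq_inv/pres_repr. Qed.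

Lemma pres_mulA : associative pres_mul.
Proof.
move=> x y z; rewrite -[x]pres_classK -[y]pres_classK -[z]pres_classK.
by rewrite !pres_mulE catA.
Qed.

Lemma pres_mul1 : left_id pres_one pres_mul.
Proof. by move=> x; rewrite -[x]pres_classK pres_mulE. Qed.

Lemma pres_mulr1 : right_id pres_one pres_mul.
Proof. by move=> x; rewrite -[x]pres_classK pres_mulE cats0. Qed.

Lemma pres_mulV : left_inverse pres_one pres_inv pres_mul.
Proof.
move=> x; rewrite -[x]pres_classK pres_invE pres_mulE.
exact/pres_classP/pres_eq_Vmul.
Qed.

Lemma pres_mulrV : right_inverse pres_one pres_inv pres_mul.
Proof.
move=> x; rewrite -[x]pres_classK pres_invE pres_mulE.
exact/pres_classP/pres_eq_mulV.
Qed.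

HB.instance Definition _ := isGroup.Build presented
  pres_mulA pres_mul1 pres_mulr1 pres_mulV pres_mulrV.

End Presentation.

Section FreeNil2.
Variable S : choiceType.

Definition nil2_rel (u v : word S) : Prop :=
  exists x y z : S,
    let c := comm_word (gen_word x) (gen_word y) in
    u = c ++ gen_word z /\ v = gen_word z ++ c.

Definition free_nil2 : groupType := presented nil2_rel.

Definition nil2_gen (s : S) : free_nil2 := pres_class nil2_rel (gen_word s).

End FreeNil2.

Definition growth (G : groupType) (I : finType) (gen : I -> G) (n : nat) :=
  #|` [fset (\prod_(i <- w) gen i)%g | w : n.-tuple I in {: n.-tuple I}]%fset |.

(* Main.v *)
(* Write c_ji for the central commutator [x_j, x_i].
   Upper bound: collecting letters brings a word of length n to the form
   x_0^a_0 ... x_(m-1)^a_(m-1) * prod_(i < j) c_ji^k_ji, with the a_i summing to n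
   and 0 <= k_ji <= n^2; this leaves m - 1 parameters of size n and m(m-1)/2
   parameters of size n^2, that is n^(m^2-1) elements up to a constant.
   Lower bound: the exponent sums and, for s <> t, the coefficient of s t in the
   Magnus expansion are invariants of the group element. For positive words the
   latter counts the occurrences of s before t. Take a word s_0^c_0 s_1^c_1 ...
   followed, for every pair s < t, by a block with L letters s, L letters t and a
   prescribed number < L^2 of occurrences of s before t, where L = n / m^2. The
   blocks have fixed exponents, so all the parameters can be recovered. *)

Require Import Defs.
From mathcomp Require Import all_boot all_order all_algebra finmap zify ring.
From mathcomp Require Import all_classical all_reals all_analysis.
Import numFieldNormedType.Exports.
Import Order.TTheory GRing.Theory Num.Theory.
Local Open Scope classical_set_scope.
Local Open Scope ring_scope.

Set Implicit Arguments.
Unset Strict Implicit.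
Unset Printing Implicit Defensive.

(** * Counting products through lists and injective encodings *)

Lemma growth_le_size (G : groupType) (I : finType) (gen : I -> G) (n : nat)
    (s : seq G) :
  (forall w : seq I, size w = n -> (\prod_(i <- w) gen i)%g \in s) ->
  (growth gen n <= size s)%N.
Proof.
move=> sP; apply: uniq_leq_size (fset_uniq _) _ => _ /imfsetP[w _ ->].
by apply: sP; rewrite size_tuple.
Qed.

Lemma card_le_growth (G : groupType) (I T : finType) (gen : I -> G) (n : nat)
    (f : T -> seq I) :
  (forall t, size (f t) = n) ->
  injective (fun t => \prod_(i <- f t) gen i)%g -> (#|T| <= growth gen n)%N.
Proof.
move=> fn f_inj; rewrite cardT -(size_map (fun t => \prod_(i <- f t) gen i)%g).
apply: uniq_leq_size => [|_ /mapP[t _ ->]].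
  by rewrite map_inj_uniq ?enum_uniq.
by have /eqP fnP := fn t; apply/imfsetP; exists (Tuple fnP).
Qed.

(** Used to count normal forms: the candidate lists are multiplied one factor at a time. Repetitions
    in [r] are harmless for an upper bound. *)
Lemma big_cover (T : eqType) (x0 : T) (op : Monoid.law x0) (n : nat)
    (s : nat -> seq T) :
  {r : seq T | size r = (\prod_(0 <= i < n) size (s i))%N &
    forall y : nat -> T, (forall i, (i < n)%N -> y i \in s i) ->
      \big[op/x0]_(0 <= i < n) y i \in r}.
Proof.
elim: n => [|n [r szr rP]].
  by exists [:: x0]; rewrite ?big_geq // => y _; rewrite big_geq ?mem_head.
exists [seq op a b | a <- r, b <- s n].
  by rewrite size_allpairs big_nat_recr //= szr.
move=> y yP; rewrite big_nat_recr //=; apply: allpairs_f; last exact: yP.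
by apply: rP => i /leqW/yP.
Qed.

(** * Collection of letters when the commutators are central *)

Section NormalForm.
Local Open Scope group_scope.
Variables (G : groupType) (x : nat -> G).
Hypothesis central : forall i j k, commute [~ x i, x j] (x k).

Definition comm_prod (m : nat) (k : nat -> nat -> nat) : G :=
  \prod_(0 <= j < m) \prod_(0 <= i < j) [~ x j, x i] ^+ k j i.

Lemma commute_comm i j k l : commute [~ x i, x j] [~ x k, x l].
Proof.
rewrite [X in commute _ X]commgEl conjgE.
have ck := central i j k; have cl := central i j l.
exact: commuteM (commuteV ck) (commuteM (commuteV cl) (commuteM ck cl)).
Qed.

Lemma comm_prodD m k k' :
  comm_prod m (fun j i => k j i + k' j i)%N = comm_prod m k * comm_prod m k'.
Proof.
rewrite -prodgM_commute => [|j j' _ _]; last first.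
  apply: commute_prod => i _; apply/commuteX/commute_sym.
  by apply: commute_prod => i' _; apply/commuteX/commute_comm.
apply: eq_bigr => j _; rewrite -prodgM_commute => [|i i' _ _]; last first.
  exact/commuteX2/commute_comm.
by apply: eq_bigr => i _; rewrite expgnDr.
Qed.

(** Puts the commutators created by collecting one letter into the shape of [comm_prod], so that
    [comm_prodD] can merge them with the earlier ones. *)
Lemma comm_prod_row m l (a : nat -> nat) : (l < m)%N ->
  comm_prod m (fun j i => (j == l) * a i)%N =
  \prod_(0 <= i < l) [~ x l, x i] ^+ a i.
Proof.
move=> lm; have row0 j : j != l ->
    \prod_(0 <= i < j) [~ x j, x i] ^+ ((j == l) * a i) = 1.
  by move=> /negPf ->; rewrite big1.
rewrite /comm_prod (big_cat_nat (n := l)) //=; last exact: ltnW.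
rewrite big1_seq => [|j]; last first.
  by rewrite mem_index_iota => /andP[_ jl]; rewrite row0 ?ltn_eqF.
rewrite mul1g big_ltn // [X in _ * X = _]big1_seq => [|j]; last first.
  by rewrite mem_index_iota => /and3P[_ lj _]; rewrite row0 ?gtn_eqF.
by rewrite mulg1; apply: eq_bigr => i _; rewrite eqxx mul1n.
Qed.

(** The new letter travels right only until it meets the power of [x l]; each [x i] that it crosses
    on the way has [i < l] and leaves behind one central [[~ x l, x i]]. *)
Lemma mul_prod_pow m l (a : nat -> nat) : (l < m)%N ->
  x l * \prod_(0 <= i < m) x i ^+ a i =
  (\prod_(0 <= i < m) x i ^+ (a i + (i == l))) *
  \prod_(0 <= i < l) [~ x l, x i] ^+ a i.
Proof.
move=> lm.
(* Conjugation by the inverse of [x l] sends [x i] to [x i * [~ x l, x i]], a product of commuting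
   factors, so its powers split. *)
have comm_l i : x l * x i ^+ a i = x i ^+ a i * [~ x l, x i] ^+ a i * x l.
  rewrite -expgMn; last exact/commute_sym.
  rewrite conjgCV conjXg; congr (_ ^+ _ * _).
  by rewrite conjgE invgK mulgA (commgC (x l)) -mulgA (commuteV (central l i l))
    mulgA mulgK.
have past n : x l * \prod_(0 <= i < n) x i ^+ a i =
    (\prod_(0 <= i < n) x i ^+ a i) *
    (\prod_(0 <= i < n) [~ x l, x i] ^+ a i) * x l.
  rewrite -prodgM_commute => [|i j _ _]; last first.
    exact/commuteX2/commute_sym.
  elim: n => [|n IHn]; first by rewrite !big_geq // mulg1 mul1g.
  by rewrite !big_nat_recr //= mulgA IHn -!mulgA comm_l !mulgA.
have central_row y : (forall j, commute [~ x l, x j] y) ->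
    commute (\prod_(0 <= i < l) [~ x l, x i] ^+ a i) y.
  move=> yP; apply/commute_sym/commute_prod => i _.
  exact/commuteX/commute_sym.
rewrite [in LHS](big_cat_nat (n := l)) //=; last exact: ltnW.
rewrite [in RHS](big_cat_nat (n := l)) //=; last exact: ltnW.
rewrite mulgA past !(big_ltn lm) eqxx addn1 expgS.
rewrite -!mulgA; congr (_ * _).
  by rewrite !big_nat; apply: eq_bigr => i /andP[_ il]; rewrite ltn_eqF ?addn0.
rewrite central_row => [|j]; last first.
  do !apply: commuteM => //; first exact: commuteX.
  by apply: commute_prod => i _; apply: commuteX.
rewrite -!mulgA; congr (_ * (_ * (_ * _))).
by rewrite !big_nat; apply: eq_bigr => i /andP[li _]; rewrite gtn_eqF ?addn0.
Qed.

Lemma prod_normal_form m (w : seq nat) : all (fun l => l < m)%N w ->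
  exists2 k : nat -> nat -> nat, (forall j i, (k j i <= size w ^ 2)%N) &
    \prod_(l <- w) x l =
    (\prod_(0 <= i < m) x i ^+ count_mem i w) * comm_prod m k.
Proof.
elim: w => [_|l w IHw /= /andP[lm /IHw[k kw prod_w]]].
  exists (fun _ _ => 0%N) => //; rewrite big_nil /comm_prod !big1 ?mul1g //.
  by move=> j _; rewrite big1.
(* Prepending [l] adds at most [size w] to each entry of row [l], and
   [size w ^ 2 + size w <= (size w).+1 ^ 2]. *)
exists (fun j i => k j i + (j == l) * count_mem i w)%N => [j i|].
  have := kw j i; have := count_size (pred1 i) w; rewrite -!mulnn /=.
  by case: (j == l); rewrite ?mul1n ?mul0n; nia.
rewrite big_cons prod_w mulgA mul_prod_pow // comm_prodD comm_prod_row //.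
rewrite -!mulgA; congr (_ * _).
  by apply: eq_bigr => i _; rewrite addnC eq_sym.
apply/commute_sym/commute_prod => i _; apply/commuteX/commute_sym.
by do 2!apply: commute_prod => ? _; apply/commuteX/commute_comm.
Qed.

End NormalForm.

(** * Upper bound for [m.+1] generators *)

Section UpperBound.
Local Open Scope group_scope.

Lemma nil2_gen_central (S : choiceType) (s t u : S) :
  commute [~ nil2_gen s, nil2_gen t] (nil2_gen u).
Proof.
have mulE (a b : word S) :
    pres_class _ (a ++ b) = pres_class (@nil2_rel S) a * pres_class _ b.
  by symmetry; apply: pres_mulE.
have invE (a : word S) : pres_class _ (inv_word a) = (pres_class (@nil2_rel S) a)^-1.
  by symmetry; apply: pres_invE.
have commE : pres_class _ (comm_word (gen_word s) (gen_word t)) =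
    [~ nil2_gen s, nil2_gen t].
  by rewrite /comm_word (mulE (inv_word _)) (mulE (inv_word _)) mulE !invE.
rewrite /commute -commE /nil2_gen -(mulE (comm_word _ _)) -(mulE (gen_word u)).
by apply/pres_classP/pres_eq_rel; exists s, t, u.
Qed.

Lemma sum_count_mem (I : finType) (w : seq I) :
  (\sum_i count_mem i w)%N = size w.
Proof.
elim: w => [|l w IHw] /=; first exact: big1.
by rewrite big_split /= IHw (bigD1 l) //= eqxx big1 // => i /negPf; rewrite eq_sym => ->.
Qed.

Lemma growth_nil2_le (m n : nat) :
  (growth (@nil2_gen 'I_m.+1) n <= n.+1 ^ m * (n ^ 2).+1 ^ 'C(m.+1, 2))%N.
Proof.
(* [inord] extends the generators to all natural indices, as the collection lemmas expect. *)
pose x i := nil2_gen (inord i : 'I_m.+1).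
have xP i j k : commute [~ x i, x j] (x k) by exact: nil2_gen_central.
pose s j i := [seq [~ x j, x i] ^+ k | k <- iota 0 (n ^ 2).+1].
pose row j := big_cover (@monoid.mul (free_nil2 'I_m.+1)) j (s j).
pose r2 := big_cover (@monoid.mul (free_nil2 'I_m.+1)) m.+1 (fun j => s2val (row j)).
(* The exponents of a positive word of length [n] add up to [n], so the last one is computed from
   the other [m]. *)
pose low_part (f : {ffun 'I_m -> 'I_n.+1}) :=
  \prod_(i < m) x i ^+ f i * x m ^+ (n - \sum_(i < m) f i)%N.
have -> : (n.+1 ^ m * (n ^ 2).+1 ^ 'C(m.+1, 2) =
    size [seq (a * b)%g | a <- codom low_part, b <- s2val r2])%N.
  rewrite size_allpairs size_codom card_ffun !card_ord (s2valP r2); congr (_ * _)%N.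
  rewrite -bin2_sum expn_sum; apply: eq_bigr => j _.
  rewrite (s2valP (row j)) (eq_bigr (fun=> (n ^ 2).+1)) => [|i _].
    by rewrite prod_nat_const_nat subn0.
  by rewrite size_map size_iota.
apply: growth_le_size => w szw.
have -> : \prod_(i <- w) nil2_gen i = \prod_(l <- map val w) x l.
  by rewrite big_map; apply: eq_bigr => i _; rewrite /x inord_val.
have wP : all (fun l => l < m.+1)%N (map val w).
  by apply/allP => _ /mapP[i _ ->]; apply: ltn_ord.
have [k] := prod_normal_form xP wP; rewrite size_map szw => kn ->.
apply: allpairs_f; last first.
  apply: (s2valP' r2) => j _; apply: (s2valP' (row j)) => i _.
  by apply: map_f; rewrite mem_iota ltnS kn.
have countE (i : 'I_m.+1) : count_mem (i : nat) (map val w) = count_mem i w.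
  by rewrite count_map; apply: eq_count => j /=; rewrite (inj_eq val_inj).
have countn (i : 'I_m.+1) : (count_mem (i : nat) (map val w) <= n)%N.
  by rewrite countE -szw count_size.
pose f0 : {ffun 'I_m -> 'I_n.+1} :=
  [ffun i : 'I_m => inord (count_mem (i : nat) (map val w))].
have f0E i : f0 i = count_mem (i : nat) (map val w) :> nat.
  by rewrite ffunE inordK // ltnS; apply: (countn (widen_ord (leqnSn m) i)).
suff -> : \prod_(0 <= i < m.+1) x i ^+ count_mem i (map val w) = low_part f0.
  exact: codom_f.
rewrite big_mkord big_ord_recr /=; congr (_ * _ ^+ _).
  by apply: eq_bigr => i _; rewrite f0E.
have nE : n = (\sum_(i < m) f0 i + count_mem m (map val w))%N.
  rewrite -[LHS]szw -sum_count_mem big_ord_recr /= -(countE ord_max) /=.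
  by congr addn; apply: eq_bigr => i _; rewrite f0E -countE.
by rewrite [X in (X - _)%N]nE addKn.
Qed.

End UpperBound.

(** * Exponent sums and Magnus coefficients as invariants *)

Section Invariants.
Variable S : choiceType.
Implicit Types (s t : S) (u v : word S).

Definition letter_exp s (a : S * bool) : int :=
  if a.1 == s then if a.2 then 1 else -1 else 0.

Definition expsum s u : int := \sum_(a <- u) letter_exp s a.

(* The coefficient of the monomial [s t] in the Magnus expansion of [u], for
   [s != t]. *)
Fixpoint pairsum s t u : int :=
  if u is a :: v then
    letter_exp s a * expsum t v + pairsum s t v
  else 0.

Lemma expsum_cat s : {morph expsum s : u v / u ++ v >-> u + v}.
Proof. by move=> u v; rewrite /expsum big_cat. Qed.

(** The cross term is the product of the linear coefficients, as when two Magnus expansions are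
    multiplied. *)
Lemma pairsum_cat s t u v :
  pairsum s t (u ++ v) = pairsum s t u + pairsum s t v + expsum s u * expsum t v.
Proof.
elim: u => [|a u IHu] /=; first by rewrite /expsum big_nil mul0r addr0 add0r.
by rewrite IHu expsum_cat [expsum s (a :: u)]big_cons -/(expsum s u); ring.
Qed.

Lemma expsum_comm s x y : expsum s (comm_word (gen_word x) (gen_word y)) = 0.
Proof.
rewrite /expsum !big_cons big_nil /letter_exp /=.
by case: (x == s); case: (y == s).
Qed.

Lemma expsum_pres_eq s u v : pres_eq (@nil2_rel S) u v -> expsum s u = expsum s v.
Proof.
elim=> // {u v} [u v w _ -> //|u u' v v' _ eu _ ev|a|u v [x [y [z [-> ->]]]]].
- by rewrite !expsum_cat eu ev.
- rewrite /expsum !big_cons big_nil /letter_exp /=.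
  by case: (a.1 == s); case: a.2.
- by rewrite !expsum_cat addrC.
Qed.

(** A commutator has zero exponent sums, hence no cross term with [z] on either side. A cancelling
    pair involves a single generator, so it contributes nothing when [s != t]. *)
Lemma pairsum_pres_eq s t u v : s != t ->
  pres_eq (@nil2_rel S) u v -> pairsum s t u = pairsum s t v.
Proof.
move=> st; elim=> // {u v} [u v w _ -> //|u u' v v' eu IHu ev IHv|a|u v].
- by rewrite !pairsum_cat IHu IHv (expsum_pres_eq s eu) (expsum_pres_eq t ev).
- rewrite /= /expsum !big_cons !big_nil /letter_exp /=.
  by have [->|_] := eqVneq a.1 s; rewrite ?(negPf st) /=; ring.
- by move=> [x [y [z [-> ->]]]]; rewrite !pairsum_cat !expsum_comm; ring.
Qed.

Definition pos_word (w : seq S) : word S := [seq (s, true) | s <- w].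

Lemma prod_nil2_gen (w : seq S) :
  (\prod_(s <- w) nil2_gen s)%g = pres_class (@nil2_rel S) (pos_word w).
Proof.
elim: w => [|s w IHw]; first by rewrite big_nil.
by rewrite big_cons IHw; apply: (pres_mulE _ (gen_word s) (pos_word w)).
Qed.

Lemma expsum_pos s (w : seq S) : expsum s (pos_word w) = count_mem s w.
Proof.
elim: w => [|t w IHw]; rewrite /expsum ?big_nil //= big_cons.
by rewrite -/(expsum _ _) IHw PoszD /letter_exp /=; case: (t == s).
Qed.

Lemma pairsum_pos_cat s t (u v : seq S) :
  pairsum s t (pos_word (u ++ v)) = pairsum s t (pos_word u) +
    pairsum s t (pos_word v) + ((count_mem s u)%:Z * (count_mem t v)%:Z).
Proof. by rewrite /pos_word map_cat pairsum_cat !expsum_pos. Qed.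

Lemma pairsum_pos0 s t (w : seq S) :
  (s \notin w) || (t \notin w) -> pairsum s t (pos_word w) = 0.
Proof.
elim: w => //= a w IHw; rewrite !inE !negb_or expsum_pos /letter_exp => stw.
rewrite IHw ?addr0; last by case/orP: stw => /andP[_ ->]; rewrite ?orbT.
case/orP: stw => /andP[]; first by rewrite eq_sym => /negPf ->; rewrite mul0r.
by move=> _ /count_memPn ->; rewrite mulr0.
Qed.

(* The last [q] letters [t] follow all the [L] letters [s], and the middle [t]
   follows [r] of them. *)
Definition pair_block L s t (q r : nat) : seq S :=
  nseq (L - q.+1) t ++ nseq r s ++ [:: t] ++ nseq (L - r) s ++ nseq q t.

Lemma size_pair_block L s t q r : (q < L)%N -> (r < L)%N ->
  size (pair_block L s t q r) = (2 * L)%N.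
Proof. by rewrite !size_cat !size_nseq /=; lia. Qed.

Lemma count_pair_block L s t q r x : (q < L)%N -> (r < L)%N ->
  count_mem x (pair_block L s t q r) = (((s == x) + (t == x)) * L)%N.
Proof. by rewrite !count_cat !count_nseq /=; nia. Qed.

(** The digits [q] and [r] in base [L] make the coefficient take each value below [L ^ 2] exactly
    once. *)
Lemma pairsum_pair_block L s t q r : s != t -> (q < L)%N -> (r < L)%N ->
  pairsum s t (pos_word (pair_block L s t q r)) = (L * q + r)%N.
Proof.
move=> st qL rL.
have nseq0 n x : pairsum s t (pos_word (nseq n x)) = 0.
  apply: pairsum_pos0; rewrite !mem_nseq -negb_and.
  by apply/negP => /andP[/andP[_ /eqP sx] /andP[_ /eqP tx]]; rewrite sx tx eqxx in st.
rewrite !pairsum_pos_cat !nseq0 (nseq0 1%N) !count_cat !count_nseq /= !eqxx.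
rewrite [t == s]eq_sym (negPf st) /=; nia.
Qed.

Lemma mem_pair_block L s t q r x :
  x \in pair_block L s t q r -> (x == s) || (x == t).
Proof.
rewrite !mem_cat !mem_nseq inE.
by do ![case/orP] => // [/andP[_ ->]|/andP[_ ->]|->|/andP[_ ->]|/andP[_ ->]];
  rewrite ?orbT.
Qed.

(* Only the exponents of the blocks enter the mixed terms of [pairsum_cat]. *)
Lemma pairsum_bigcat_sub (I : Type) (r : seq I) (u v : I -> word S) s t :
  (forall i x, expsum x (u i) = expsum x (v i)) ->
  pairsum s t (\big[cat/[::]]_(i <- r) u i) -
    pairsum s t (\big[cat/[::]]_(i <- r) v i) =
  \sum_(i <- r) (pairsum s t (u i) - pairsum s t (v i)).
Proof.
move=> uv; elim: r => [|i r IHr]; first by rewrite !big_nil subrr.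
rewrite !big_cons -IHr !pairsum_cat uv.
have expsum0 x : expsum x [::] = 0 by rewrite /expsum big_nil.
rewrite !(big_morph _ (expsum_cat t) (expsum0 t)).
by rewrite (eq_bigr (fun i => expsum t (v i))) => [|j _]; [ring | apply: uv].
Qed.

End Invariants.

(** * Lower bound: encoding independent parameters in words of length [n] *)

Section LowerBound.
Variables (m n L : nat).
Hypothesis Ln : (m.+1 ^ 2 * L <= n)%N.

Local Notation pair_index := {p : 'I_m.+1 * 'I_m.+1 | (p.1 < p.2)%N}.
Local Notation code :=
  ({ffun 'I_m -> 'I_L} * {ffun pair_index -> 'I_L * 'I_L})%type.

Lemma card_pair_index : #|{: pair_index}| = 'C(m.+1, 2).
Proof.
rewrite card_sig -sum1_card (eq_bigl (fun p : 'I_m.+1 * 'I_m.+1 => p.1 < p.2)%N) //.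
rewrite -(pair_big_dep xpredT (fun i j : 'I_m.+1 => (i < j)%N) (fun _ _ => 1%N)) /=.
rewrite (exchange_big_dep xpredT) //= -bin2_sum big_mkord; apply: eq_bigr => j _.
by rewrite -(big_ord_widen m.+1 (fun=> 1%N)) ?sum1_card ?card_ord // ltnW.
Qed.

(** The padding by the last generator depends on [t.1] only, so codes with equal first components
    have equal heads. *)
Definition code_pad (t : code) : nat :=
  n - \sum_(i < m) t.1 i - 'C(m.+1, 2) * (2 * L).

Definition code_block (t : code) (p : pair_index) : seq 'I_m.+1 :=
  pair_block L (val p).1 (val p).2 (t.2 p).1 (t.2 p).2.

Definition code_head (t : code) : seq 'I_m.+1 :=
  \big[cat/[::]]_(i < m) nseq (t.1 i) (widen_ord (leqnSn m) i) ++
  nseq (code_pad t) ord_max.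

Definition code_word (t : code) : seq 'I_m.+1 :=
  code_head t ++ \big[cat/[::]]_p code_block t p.

Lemma size_code_word t : size (code_word t) = n.
Proof.
have size_bigcat (I : finType) (w : I -> seq 'I_m.+1) :
    size (\big[cat/[::]]_i w i) = (\sum_i size (w i))%N.
  exact: (big_morph size (@size_cat _) erefl).
rewrite !size_cat !size_bigcat size_nseq.
rewrite (eq_bigr (fun i => t.1 i : nat)) => [|i _]; last by rewrite size_nseq.
rewrite [X in (_ + X)%N](eq_bigr (fun=> 2 * L)%N) => [|p _]; last first.
  by rewrite size_pair_block.
rewrite sum_nat_const card_pair_index /code_pad.
(* The unpadded head takes at most [m * L] letters and the blocks [m.+1 * m * L], in total at most
   [m.+1 ^ 2 * L <= n]; hence the truncated subtractions in [code_pad] are exact. *)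
have : (\sum_(i < m) t.1 i <= m * L)%N.
  rewrite -[m in leqRHS]card_ord -sum_nat_const.
  by apply: leq_sum => i _; apply: ltnW.
have -> : ('C(m.+1, 2) * (2 * L) = m.+1 * m * L)%N.
  by rewrite mulnA [('C(_, _) * 2)%N]mulnC -mul_bin_diag bin1.
by move: Ln; rewrite -mulnn; move: (\sum_(i < m) _)%N; nia.
Qed.

Lemma count_bigcat (T : eqType) (I : finType) (w : I -> seq T) x :
  count_mem x (\big[cat/[::]]_i w i) = (\sum_i count_mem x (w i))%N.
Proof. exact: (big_morph (count_mem x) (@count_cat _ _) erefl). Qed.

Lemma count_code_head t (i : 'I_m) :
  count_mem (widen_ord (leqnSn m) i) (code_head t) = t.1 i.
Proof.
have widen_neq : (ord_max == widen_ord (leqnSn m) i) = false.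
  by rewrite -val_eqE /= gtn_eqF.
rewrite count_cat count_nseq /= widen_neq addn0 count_bigcat (bigD1 i) //=.
rewrite count_nseq /= eqxx mul1n big1 ?addn0 // => j /negPf ji.
by rewrite count_nseq /= -val_eqE /= val_eqE ji.
Qed.

(** All codes have the same letter counts in their blocks, so exponent sums recover [c]. The heads
    then agree and cancel together with the cross terms, leaving only the coefficients of the
    blocks. *)
Lemma code_word_inj :
  injective (fun t => \prod_(i <- code_word t) nil2_gen i)%g.
Proof.
move=> [c k] [c' k']; rewrite !prod_nil2_gen => /pres_classP eq_w.
have count_block x p : count_mem x (code_block (c, k) p) =
    count_mem x (code_block (c', k') p).
  by rewrite !count_pair_block.
have cc : c = c'.
  apply/ffunP => i; apply: val_inj.
  have := expsum_pres_eq (widen_ord (leqnSn m) i) eq_w.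
  rewrite !expsum_pos !(count_cat _ (code_head _)) !count_code_head !count_bigcat => -[].
  by rewrite (eq_bigr _ (fun p _ => count_block _ p)) => /addIn.
rewrite -cc in eq_w count_block *; congr (_, _); apply/ffunP => p.
have st : (val p).1 != (val p).2 by rewrite -val_eqE ltn_eqF ?(valP p).
have := pairsum_pres_eq st eq_w.
rewrite !pairsum_pos_cat /code_head /code_pad /= -/(code_head (c, k)).
rewrite !count_bigcat (eq_bigr _ (fun p _ => count_block _ p)).
move=> /addIr/addrI.
have pos_bigcat t : pos_word (\big[cat/[::]]_p code_block t p) =
    \big[cat/[::]]_p pos_word (code_block t p).
  exact: (big_morph _ (@map_cat _ _ _) erefl).
move/eqP; rewrite -subr_eq0 !pos_bigcat pairsum_bigcat_sub; last first.
  by move=> q x; rewrite !expsum_pos count_block.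
rewrite (bigD1 p) //= big1 => [|q qp]; last first.
  (* Only the block of [p] contains both letters of the pair [p]. *)
  have notin t : ((val p).1 \notin code_block t q) || ((val p).2 \notin code_block t q).
    rewrite -negb_and; apply: contra qp => /andP[/mem_pair_block p1 /mem_pair_block p2].
    rewrite -val_eqE /=; move: p1 p2 (valP p) (valP q) => /=.
    case: (val p) (val q) => [a b] [a' b'] /= /orP[] /eqP -> /orP[] /eqP -> //;
      by rewrite ?ltnn // => ab /(ltn_trans ab); rewrite ltnn.
  by rewrite !pairsum_pos0 ?subrr.
rewrite addr0 !pairsum_pair_block // subr_eq0 => /eqP[].
case: (k p) (k' p) => [q r] [q' r'] /= kk.
(* Uniqueness of the digits in base [L]. *)
have eq_q : q = q' :> nat by have := ltn_ord r; have := ltn_ord r'; nia.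
by congr (_, _); apply: val_inj => //; move: kk; rewrite eq_q => /addnI.
Qed.

Lemma growth_nil2_ge : (L ^ (m.+1 ^ 2 - 1) <= growth (@nil2_gen 'I_m.+1) n)%N.
Proof.
apply: leq_trans (card_le_growth size_code_word code_word_inj).
rewrite card_prod !card_ffun card_prod !card_ord card_pair_index.
rewrite mulnn -expnM -expnD leq_eqVlt; apply/orP; left; apply/eqP; congr (_ ^ _)%N.
(* The number of parameters below [L] is [m + 2 * 'C(m.+1, 2)], where
   [2 * 'C(m.+1, 2) = m.+1 * m]. *)
by have := mul_bin_diag m.+1 1; rewrite bin1 -mulnn; nia.
Qed.

End LowerBound.

(** * From the two counts to explicit constants *)

Lemma leq_exp2r_imp (a b k : nat) : (a <= b)%N -> (a ^ k <= b ^ k)%N.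
Proof. by case: k => // k ab; rewrite leq_exp2r. Qed.

Lemma growth_nil2_upper (m n : nat) : (0 < n)%N ->
  (growth (@nil2_gen 'I_m.+1) n <=
     2 ^ (m + 'C(m.+1, 2)) * n ^ (m.+1 ^ 2 - 1))%N.
Proof.
move=> n0; apply: leq_trans (growth_nil2_le m n) _.
have -> : (m.+1 ^ 2 - 1 = m + 2 * 'C(m.+1, 2))%N.
  by have := mul_bin_diag m.+1 1; rewrite bin1 -mulnn; nia.
move: 'C(m.+1, 2) => c; rewrite (expnD 2) (expnD n) (expnM n 2) mulnACA -!expnMn.
(* As [n > 0], [n.+1 <= 2 * n] and [(n ^ 2).+1 <= 2 * n ^ 2]: each factor costs a 2. *)
by apply: leq_mul; apply: leq_exp2r_imp;
  rewrite mul2n -addnn -addn1 leq_add2l ?expn_gt0 ?n0.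
Qed.

Lemma growth_nil2_lower (m n : nat) : (m.+1 ^ 2 <= n)%N ->
  (n ^ (m.+1 ^ 2 - 1) <=
     (2 * m.+1 ^ 2) ^ (m.+1 ^ 2 - 1) * growth (@nil2_gen 'I_m.+1) n)%N.
Proof.
move=> mn; set L := (n %/ m.+1 ^ 2)%N.
have Ln : (m.+1 ^ 2 * L <= n)%N by rewrite mulnC leq_trunc_div.
apply: leq_trans (leq_mul (leqnn _) (growth_nil2_ge Ln)).
rewrite -expnMn; apply: leq_exp2r_imp.
have L0 : (0 < L)%N by rewrite divn_gt0 ?expn_gt0.
(* Since [L >= 1], [n < L.+1 * m.+1 ^ 2 <= 2 * m.+1 ^ 2 * L]. *)
have := ltn_ceil n (isT : 0 < m.+1 ^ 2)%N; rewrite -/L; nia.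
Qed.

Theorem mainTheorem5 (R : realType) (m : nat) (hm : (3 <= m)%N) :
  (fun n : nat => (growth (@nil2_gen 'I_m) n)%:R : R^o) \is
    'Theta_\oo (fun n : nat => n%:R ^+ (m ^ 2 - 1) : R^o).
Proof.
case: m hm => // m _; rewrite qualifE; apply/asboolP.
set e := (m.+1 ^ 2 - 1)%N.
pose K := ((2 * m.+1 ^ 2) ^ e)%N; pose K' := (2 ^ (m + 'C(m.+1, 2)))%N.
have K_gt0 : (0 : R) < K%:R by rewrite ltr0n expn_gt0 muln_gt0 expn_gt0.
exists (K%:R^-1, K'%:R) => /=; first by rewrite invr_gt0 K_gt0 ltr0n expn_gt0.
near=> n.
have mn : (m.+1 ^ 2 <= n)%N by near: n; apply: nbhs_infty_ge.
rewrite -natrX !ger0_norm ?ler0n //; split; last first.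
  by rewrite -natrM ler_nat growth_nil2_upper // (leq_trans _ mn) ?expn_gt0.
by rewrite ler_pdivrMl // -natrM ler_nat growth_nil2_lower.
Unshelve. all: by end_near.
Qed.
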